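(* Let $\Gamma$ be a finite connected simplicial graph which does not split as a nontrivial join, so that $A(\Gamma)$ contains at least one loxodromic element. Then the canonical inclusion $A(\Gamma)\to A(\Gamma)\times\mathbb{Z}$ is an injective map which does not preserve loxodromic elements.
   Context: $A(\Gamma)=\langle V(\Gamma)\mid [a,b]=1 \text{ for each } \{a,b\}\in E(\Gamma)\rangle$ is the right-angled Artin group on $\Gamma$. A graph is a (nontrivial) join if its vertex set is a disjoint union of two nonempty subsets such that every vertex of one is adjacent to every vertex of the other. The group $A(\Gamma)\times\mathbb{Z}$ is regarded as the right-angled Artin group on the join of $\Gamma$ with a single vertex. The extension graph $\Gamma^e$ has vertex set $\{v^g : v\in V(\Gamma), g\in A(\Gamma)\}$, where $v^g=g^{-1}vg$, with two distinct vertices adjacent if and only if they commute in $A(\Gamma)$; it carries the graph metric $d$, and $A(\Gamma)$ acts on it by conjugation, $g$ sending $v^h$ to $v^{hg}$. An element $g\in A(\Gamma)$ is loxodromic if $\lim_{n\to\infty}\frac1n d(x,x^{g^n})>0$ for $x\in\Gamma^e$. An injective homomorphism between right-angled Artin groups preserves loxodromic elements if it sends every loxodromic element to a loxodromic element.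
   Formalization: The graph Γ is assumed to have at least two vertices: for a single vertex, A(Γ)=Z, the extension graph is a point, no element is loxodromic, and the inclusion vacuously preserves loxodromic elements. *)

(* Defs.v *)
From HB Require Import structures.
From mathcomp Require Import all_boot all_order all_algebra.

Set Implicit Arguments.
Unset Strict Implicit.
Unset Printing Implicit Defensive.

Record sgraph := SGraph {
  svertex :> finType;
  sadj : rel svertex;
  sadj_sym : symmetric sadj;
  sadj_irr : irreflexive sadj
}.

Definition sgraph_connected (G : sgraph) : Prop :=
  forall x y : G, connect (@sadj G) x y.

Definition splits_as_join (G : sgraph) : Prop :=
  exists A B : {set G},
    [/\ A != set0, B != set0, [disjoint A & B], A :|: B = [set: G]
      & {in A & B, forall a b, sadj a b}].

Section Join.
Variables G H : sgraph.

Definition join_adj (x y : G + H) : bool :=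
  match x, y with
  | inl a, inl b => sadj a b
  | inr a, inr b => sadj a b
  | _, _ => true
  end.

Fact join_adj_sym : symmetric join_adj.
Proof. by case=> a [] b //=; rewrite sadj_sym. Qed.

Fact join_adj_irr : irreflexive join_adj.
Proof. by case=> a //=; rewrite sadj_irr. Qed.

Definition sjoin : sgraph := SGraph join_adj_sym join_adj_irr.
End Join.

Definition point_graph : sgraph :=
  @SGraph unit (fun _ _ => false) (fun _ _ => erefl) (fun _ => erefl).

From mathcomp Require Import all_classical all_reals all_analysis.

Import Order.TTheory GRing.Theory Num.Theory.
Local Open Scope classical_set_scope.
Local Open Scope quotient_scope.
Local Open Scope group_scope.

Section Presentation.
Variable X : choiceType.

(* The letter (x, true) stands for the generator x, and (x, false) for its
   formal inverse. *)
Definition word := seq (X * bool).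

Variable relators : set word.

Inductive pres_eq : word -> word -> Prop :=
| pres_refl u : pres_eq u u
| pres_sym u v : pres_eq u v -> pres_eq v u
| pres_trans u v w : pres_eq u v -> pres_eq v w -> pres_eq u w
| pres_cancel u w x b : pres_eq (u ++ [:: (x, b); (x, ~~ b)] ++ w) (u ++ w)
| pres_relator u w r : relators r -> pres_eq (u ++ r ++ w) (u ++ w).

Definition pres_eqb (u v : word) : bool := `[< pres_eq u v >].

Fact pres_eqb_refl : reflexive pres_eqb.
Proof. by move=> u; apply/asboolP; exact: pres_refl. Qed.

Fact pres_eqb_sym : symmetric pres_eqb.
Proof.
by move=> u v; apply/asboolP/asboolP; exact: pres_sym.
Qed.

Fact pres_eqb_trans : transitive pres_eqb.
Proof.
move=> v u w /asboolP uv /asboolP vw; apply/asboolP; exact: pres_trans uv vw.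
Qed.

Canonical pres_equiv :=
  EquivRel pres_eqb pres_eqb_refl pres_eqb_sym pres_eqb_trans.

Definition presented : Type := {eq_quot pres_equiv}.
HB.instance Definition _ := Choice.on presented.
HB.instance Definition _ := EqQuotient.on presented.

Lemma presP (u v : word) : \pi_presented u = \pi_presented v <-> pres_eq u v.
Proof.
by split=> [/eqmodP /asboolP | uv] //; apply/eqmodP/asboolP.
Qed.

Definition inv_word (u : word) : word := rev [seq (l.1, ~~ l.2) | l <- u].

Lemma inv_wordK : involutive inv_word.
Proof.
move=> u; rewrite /inv_word map_rev revK -map_comp -[RHS]map_id.
by apply: eq_map => -[x b] /=; rewrite negbK.
Qed.

Lemma pres_eq_catl p u v : pres_eq u v -> pres_eq (p ++ u) (p ++ v).
Proof.
elim=> {u v} [u|u v _|u v w _ uv _|u w x b|u w r rr].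
- exact: pres_refl.
- exact: pres_sym.
- exact: pres_trans.
- by rewrite !(catA p); exact: pres_cancel.
- by rewrite !(catA p); exact: pres_relator.
Qed.

Lemma pres_eq_catr s u v : pres_eq u v -> pres_eq (u ++ s) (v ++ s).
Proof.
elim=> {u v} [u|u v _|u v w _ uv _|u w x b|u w r rr].
- exact: pres_refl.
- exact: pres_sym.
- exact: pres_trans.
- by rewrite -!catA; exact: pres_cancel.
- by rewrite -!catA; exact: pres_relator.
Qed.

Lemma pres_eq_cat u u' v v' :
  pres_eq u u' -> pres_eq v v' -> pres_eq (u ++ v) (u' ++ v').
Proof.
by move=> uu vv; apply: pres_trans (pres_eq_catr v uu) (pres_eq_catl u' vv).
Qed.

Lemma pres_eq_Vl u : pres_eq (inv_word u ++ u) [::].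
Proof.
elim: u => [|[x b] u IH]; first exact: pres_refl.
rewrite /inv_word /= rev_cons -cats1 -catA /=.
apply: pres_trans IH.
by have := pres_cancel (inv_word u) u x (~~ b); rewrite negbK.
Qed.

Lemma pres_eq_Vr u : pres_eq (u ++ inv_word u) [::].
Proof. by have := pres_eq_Vl (inv_word u); rewrite inv_wordK. Qed.

Lemma pres_eq_inv u v : pres_eq u v -> pres_eq (inv_word u) (inv_word v).
Proof.
move=> uv; apply: (@pres_trans _ (inv_word u ++ (v ++ inv_word v))).
  by apply: pres_sym; rewrite -[X in pres_eq _ X]cats0;
     apply: pres_eq_catl; exact: pres_eq_Vr.
rewrite catA -[X in pres_eq _ X]cat0s; apply: pres_eq_catr.
apply: pres_trans (pres_eq_Vl u); apply: pres_eq_catl.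
exact: pres_sym.
Qed.

Definition pres_one : presented := \pi_presented [::].
Definition pres_mul (x y : presented) : presented := \pi_presented (repr x ++ repr y).
Definition pres_inv (x : presented) : presented := \pi_presented (inv_word (repr x)).

Lemma presW (P : presented -> Prop) :
  (forall u, P (\pi_presented u)) -> forall x, P x.
Proof. by move=> Pu x; rewrite -[x]reprK. Qed.

Lemma pres_repr u : pres_eq (repr (\pi_presented u)) u.
Proof. by apply/presP; rewrite reprK. Qed.

Lemma pres_mul_pi u v :
  pres_mul (\pi_presented u) (\pi_presented v) = \pi_presented (u ++ v).
Proof. by apply/presP; apply: pres_eq_cat; exact: pres_repr. Qed.

Lemma pres_inv_pi u : pres_inv (\pi_presented u) = \pi_presented (inv_word u).
Proof. by apply/presP; apply: pres_eq_inv; exact: pres_repr. Qed.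

Fact pres_mulA : associative pres_mul.
Proof.
elim/presW=> u; elim/presW=> v; elim/presW=> w.
by rewrite !pres_mul_pi catA.
Qed.

Fact pres_mul1 : left_id pres_one pres_mul.
Proof. by elim/presW=> u; rewrite pres_mul_pi. Qed.

Fact pres_mulr1 : right_id pres_one pres_mul.
Proof. by elim/presW=> u; rewrite pres_mul_pi cats0. Qed.

Fact pres_mulV : left_inverse pres_one pres_inv pres_mul.
Proof.
elim/presW=> u; rewrite pres_inv_pi pres_mul_pi; apply/presP.
exact: pres_eq_Vl.
Qed.

Fact pres_mulVr : right_inverse pres_one pres_inv pres_mul.
Proof.
elim/presW=> u; rewrite pres_inv_pi pres_mul_pi; apply/presP.
exact: pres_eq_Vr.
Qed.

HB.instance Definition _ :=
  isGroup.Build presented pres_mulA pres_mul1 pres_mulr1 pres_mulV pres_mulVr.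

Definition pres_gen (x : X) : presented := \pi_presented [:: (x, true)].

Lemma presM u v : \pi_presented (u ++ v) = \pi_presented u * \pi_presented v.
Proof. by rewrite [RHS]pres_mul_pi. Qed.

Lemma pres1 : \pi_presented [::] = 1.
Proof. by []. Qed.

Lemma presV u : \pi_presented (inv_word u) = (\pi_presented u)^-1.
Proof. by rewrite [RHS]pres_inv_pi. Qed.

Section Lift.
Variables (H : groupType) (f : X -> H).

Definition word_eval (u : word) : H :=
  \prod_(l <- u) (if l.2 then f l.1 else (f l.1)^-1).

(* The homomorphism extending f, provided that f kills the relators
   (see pres_lift_pi and pres_liftM). *)
Definition pres_lift (x : presented) : H := word_eval (repr x).

Lemma word_eval_cat u v : word_eval (u ++ v) = word_eval u * word_eval v.
Proof. by rewrite /word_eval big_cat. Qed.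

Hypothesis f_rel : forall r, relators r -> word_eval r = 1.

Lemma word_eval_eq u v : pres_eq u v -> word_eval u = word_eval v.
Proof.
elim=> {u v} [u|u v _|u v w _ -> _|u w x b|u w r rr] //.
- rewrite [LHS]word_eval_cat [RHS]word_eval_cat; congr (_ * _).
  by case: b; rewrite /word_eval !big_cons /= ?mulVKg ?mulKg.
- by rewrite word_eval_cat [X in _ * X]word_eval_cat (f_rel rr) mul1g -word_eval_cat.
Qed.

Lemma pres_lift_pi u : pres_lift (\pi_presented u) = word_eval u.
Proof. exact/word_eval_eq/pres_repr. Qed.

Lemma pres_lift_gen x : pres_lift (pres_gen x) = f x.
Proof. by rewrite pres_lift_pi /word_eval big_seq1. Qed.

Lemma pres_liftM : {morph pres_lift : x y / x * y}.
Proof.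
elim/presW=> u; elim/presW=> v; rewrite -presM !pres_lift_pi.
exact: word_eval_cat.
Qed.

Lemma pres_lift1 : pres_lift 1 = 1.
Proof. by rewrite -pres1 pres_lift_pi /word_eval big_nil. Qed.

End Lift.

Lemma pres_hom_ext (H : groupType) (f g : presented -> H) :
    {morph f : x y / x * y} -> {morph g : x y / x * y} ->
    (forall x, f (pres_gen x) = g (pres_gen x)) -> f =1 g.
Proof.
have hom1 (h : presented -> H) : {morph h : x y / x * y} -> h 1 = 1.
  by move=> hM; apply: (mulgI (h 1)); rewrite -hM !mulg1.
have homV (h : presented -> H) : {morph h : x y / x * y} ->
    {morph h : x / x^-1}.
  by move=> hM x; apply: (mulgI (h x)); rewrite -hM !mulgV hom1.
move=> fM gM fg; elim/presW; elim=> [|[y b] u IH].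
  by rewrite pres1 !hom1.
rewrite -cat1s presM fM gM IH; congr (_ * _).
have -> : \pi_presented [:: (y, b)] = if b then pres_gen y else (pres_gen y)^-1.
  by case: b => //; rewrite -presV.
by case: b; rewrite ?homV ?fg.
Qed.

End Presentation.

Arguments pres_gen {X relators} x.

(* The relators [~ a, b] = a^-1 b^-1 a b for the edges {a, b}. *)
Definition raag_relators (G : sgraph) : set (word G) :=
  [set r | exists a b : G, sadj a b /\
    r = [:: (a, false); (b, false); (a, true); (b, true)]].

Definition raag (G : sgraph) : groupType := presented (@raag_relators G).

Definition raag_gen (G : sgraph) (v : G) : raag G := pres_gen v.

Definition raag_lift (G : sgraph) (H : groupType) (f : G -> H) : raag G -> H :=
  @pres_lift G (@raag_relators G) H f.

Section RaagLift.
Variables (G : sgraph) (H : groupType) (f : G -> H).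
Hypothesis f_comm : forall a b, sadj a b -> commute (f a) (f b).

Lemma raag_relP r : raag_relators r -> word_eval f r = 1.
Proof.
move=> [a [b [ab ->]]].
rewrite /word_eval !big_cons big_nil /= mulg1.
have /commgP/eqP := f_comm ab.
by rewrite /commg /conjg.
Qed.

Lemma raag_liftM : {morph raag_lift f : x y / x * y}.
Proof. exact: pres_liftM raag_relP. Qed.

Lemma raag_lift_gen v : raag_lift f (raag_gen v) = f v.
Proof. exact: pres_lift_gen raag_relP v. Qed.

End RaagLift.

Lemma raag_gen_commute (G : sgraph) (a b : G) :
  sadj a b -> commute (raag_gen a) (raag_gen b).
Proof.
move=> ab; apply/commgP/eqP.
pose r := [:: (a, false); (b, false); (a, true); (b, true)].
have rr : raag_relators r by exists a, b.
have genV (v : G) : \pi_(presented (@raag_relators G)) [:: (v, false)]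
    = (raag_gen v)^-1 by rewrite -presV.
transitivity (\pi_(presented (@raag_relators G)) r).
  rewrite (presM _ [:: (a, false)] [:: (b, false); (a, true); (b, true)]).
  rewrite (presM _ [:: (b, false)] [:: (a, true); (b, true)]).
  by rewrite (presM _ [:: (a, true)] [:: (b, true)]) !genV.
by rewrite -pres1; apply/presP; have := pres_relator [::] [::] rr.
Qed.

(* The group Z in multiplicative notation. *)
Definition mulZ : Type := int.
HB.instance Definition _ := Choice.on mulZ.
HB.instance Definition _ := isGroup.Build mulZ
  (@addrA int) (@add0r int) (@addr0 int) (@addNr int) (@addrN int).

Definition zexpg (H : groupType) (x : H) (n : mulZ) : H :=
  match n with Posz k => x ^+ k | Negz k => x ^- k.+1 end.

Lemma zexpgD (H : groupType) (x : H) : {morph zexpg x : m n / m * n}.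
Proof.
have zS (n : int) : zexpg x (n + 1)%R = zexpg x n * x.
  case: n => [k|[|k]].
  - by rewrite -PoszD addn1 /= expgSr.
  - by rewrite /= mulVg.
  - have -> : (Negz k.+1 + 1)%R = Negz k.
      by rewrite !NegzE -[k.+2]addn1 PoszD opprD subrK.
    by rewrite /= [X in _ = X^-1 * _]expgS invgM mulgVK.
have zP (n : int) : zexpg x (n - 1)%R = zexpg x n * x^-1.
  by apply: (mulIg x); rewrite -zS subrK mulgVK.
move=> m n; change (zexpg x ((m : int) + (n : int))%R = zexpg x m * zexpg x n).
elim/int_rect: (n : int) => [|k IH|k IH].
- by rewrite addr0 mulg1.
- by rewrite -addn1 PoszD addrA !zS IH mulgA.
- by rewrite -addn1 PoszD opprD addrA !zP IH mulgA.
Qed.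

Section ProdZ.
Variable G : sgraph.
Local Notation coneG := (sjoin G point_graph).

(* The identification of A(G) x Z with the right-angled Artin group on the join
   of G with a point, sending the generator of Z to the additional vertex; it is
   a bijective morphism (prodZ_raagM, prodZ_raag_bij). *)
Definition prodZ_raag (x : raag G * mulZ) : raag coneG :=
  raag_lift (fun v : G => raag_gen (inl v : coneG)) x.1
  * zexpg (raag_gen (inr tt : coneG)) x.2.

Let base (v : G) := raag_gen (inl v : coneG).
Let apex := raag_gen (inr tt : coneG).

Let base_comm a b : sadj a b -> commute (base a) (base b).
Proof. by move=> ab; apply: raag_gen_commute. Qed.

Let liftM := raag_liftM base_comm.

Let apex_comm x : commute (raag_lift base x) apex.
Proof.
have e : (fun x => raag_lift base x ^ apex) =1 raag_lift base.
  apply: pres_hom_ext => [y z|y z|v] /=.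
  - by rewrite liftM conjMg.
  - exact: liftM.
  - rewrite [raag_lift base _](raag_lift_gen base_comm v).
    apply/conjg_fixP/commgP.
    exact: (@raag_gen_commute coneG (inl v) (inr tt) isT).
by apply/commgP/conjg_fixP.
Qed.

Lemma prodZ_raagM : {morph prodZ_raag : x y / x * y}.
Proof.
move=> [x m] [y n]; rewrite /prodZ_raag /= liftM zexpgD -!mulgA; congr (_ * _).
rewrite !mulgA; congr (_ * _).
have c : commute (raag_lift base y) (zexpg apex m).
  case: m => k /=; last by apply/commuteV/commuteX.
  exact/commuteX.
exact: c.
Qed.

Let coords (v : coneG) : raag G * mulZ :=
  match v with inl a => (raag_gen a, 1) | inr _ => (1, 1%R : int) end.

Let coords_comm a b : sadj a b -> commute (coords a) (coords b).
Proof.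
case: a b => [a|[]] [b|[]] //= ab; apply/eqP; rewrite xpair_eqE /=.
- by rewrite raag_gen_commute //= eqxx.
- by rewrite mulg1 mul1g !eqxx.
- by rewrite mulg1 mul1g !eqxx.
Qed.

Let backM := raag_liftM coords_comm.

Lemma prodZ_raag_bij : bijective prodZ_raag.
Proof.
exists (raag_lift coords).
- move=> [x n]; rewrite /prodZ_raag /= backM.
  have -> : raag_lift coords (raag_lift base x) = (x, 1).
    move: x; apply: pres_hom_ext => [y z|y z|v] /=.
    + by rewrite liftM backM.
    + by apply/eqP; rewrite xpair_eqE eqxx /= mulg1.
    + rewrite [raag_lift base _](raag_lift_gen base_comm v).
      exact: (raag_lift_gen coords_comm).
  have back1 : raag_lift coords 1 = 1.
    by apply: (mulgI (raag_lift coords 1)); rewrite -backM !mulg1.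
  have backX k : raag_lift coords (apex ^+ k) = (1, Posz k : mulZ).
    elim: k => [|k IH]; first exact: back1.
    rewrite expgSr backM IH [raag_lift coords apex](raag_lift_gen coords_comm).
    by rewrite -addn1 PoszD; congr pair; exact: mulg1.
  have -> : raag_lift coords (zexpg apex n) = (1, n).
    case: n => k /=; first exact: backX.
    apply: (mulgI (raag_lift coords (apex ^+ k.+1))).
    rewrite -backM mulgV back1 backX; apply/eqP.
    rewrite xpair_eqE; apply/andP; split; first by rewrite /= mulg1.
    by rewrite NegzE; apply/eqP/esym; exact: (addrN (Posz k.+1)).
  by apply/eqP; rewrite xpair_eqE /= mulg1 mul1g !eqxx.
- apply: pres_hom_ext => [y z|y z|v] //=; first by rewrite backM prodZ_raagM.
  rewrite [raag_lift coords _](raag_lift_gen coords_comm v).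
  case: v => [v|[]]; rewrite /prodZ_raag /=.
    by rewrite (raag_lift_gen base_comm) mulg1.
  have -> : raag_lift (fun v : G => raag_gen (inl v : coneG)) 1 = 1.
    by apply: (mulgI (raag_lift base 1)); rewrite -liftM !mulg1.
  by rewrite mul1g.
Qed.

End ProdZ.

HB.instance Definition _ (G : sgraph) :=
  isMultiplicative.Build (raag G * mulZ)%type (raag (sjoin G point_graph))
    (@prodZ_raag G) (@prodZ_raagM G).

Definition incl_prodZ (G : sgraph) (g : raag G) : raag G * mulZ := (g, 1).

Fact incl_prodZM (G : sgraph) : {morph @incl_prodZ G : x y / x * y}.
Proof. by move=> x y; apply/eqP; rewrite xpair_eqE eqxx /= mulg1. Qed.

HB.instance Definition _ (G : sgraph) :=
  isMultiplicative.Build (raag G) (raag G * mulZ)%type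
    (@incl_prodZ G) (@incl_prodZM G).

Definition raag_incl (G : sgraph) :
    {multiplicative raag G -> raag (sjoin G point_graph)} :=
  @prodZ_raag G \o @incl_prodZ G.

Section ExtensionGraph.
Variable G : sgraph.

Definition is_vertex_conj : pred (raag G) :=
  fun x => `[< exists (v : G) (g : raag G), x = raag_gen v ^ g >].

Definition ext_vertex : choiceType := {x : raag G | is_vertex_conj x}.

Definition ext_adj : rel ext_vertex :=
  fun x y => (x != y) && (val x * val y == val y * val x).

Fact ext_act_subproof (x : ext_vertex) (g : raag G) :
  is_vertex_conj (val x ^ g).
Proof.
case: x => x /= /asboolP[v [h ->]]; apply/asboolP.
by exists v, (h * g); rewrite conjgM.
Qed.

(* In a group, x ^ g is the conjugate g^-1 x g. *)
Definition ext_act (x : ext_vertex) (g : raag G) : ext_vertex :=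
  exist _ (val x ^ g) (ext_act_subproof x g).

End ExtensionGraph.

Local Open Scope ereal_scope.

(* The graph metric; it is +oo between distinct connected components. *)
Definition graph_dist (R : realType) (T : eqType) (adj : rel T) (x y : T) :
    \bar R :=
  ereal_inf [set ((size p)%:R)%:E | p in [set p | path adj x p /\ last x p = y]].

Definition loxodromic (R : realType) (G : sgraph) (g : raag G) : Prop :=
  forall x : ext_vertex G, exists2 l : \bar R, 0 < l &
    (n%:R^-1)%:E * graph_dist R (@ext_adj G) x (ext_act x (g ^+ n)%g)
      @[n --> \oo] --> l.

Definition preserves_loxodromic (R : realType) (G H : sgraph)
    (f : {multiplicative raag G -> raag H}) : Prop :=
  forall g : raag G, loxodromic R g -> loxodromic R (f g).

(* Main.v *)
Require Import Defs.
From mathcomp Require Import all_boot all_order all_algebra.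
From mathcomp Require Import all_classical all_reals all_analysis.
From mathcomp Require Import zify ring.

(** The inclusion of [A(G)] in [A(G) x Z] cannot preserve loxodromics because
    the generator of [Z] is a vertex of the larger extension graph that is
    fixed by the whole group: every translation length there is [0]
    ([cone_not_loxodromic]).  The substance is the existence of a loxodromic
    element of [A(G)].

    Since [G] is not a join, its complement is connected, so there is a closed
    walk [c] through all vertices whose consecutive letters are never adjacent
    in [G].  The product [gword c] of its letters is loxodromic, for the
    following reason.  If two conjugates of generators [v ^ g] and [u ^ h]
    commute, then [h * g^-1] is a product of two elements, each carried by the
    star of a vertex ([commute_conj_star_like]).  A path of length [k] in the
    extension graph from [v] to its translate by [gword c ^+ n] therefore
    writes [gword c ^+ n] as a product of about [2 * k] such elements.  As no
    star contains all vertices, this forces [n <= 2 * k + C].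

    Both steps use a Magnus map instead of normal forms.  Let [T] be the ring
    of integral power series in variables [X_a], one for each vertex, where
    [X_a] and [X_b] commute when [a] and [b] are adjacent.  The assignment
    [a |-> 1 + X_a] extends to a multiplicative map [magnus] from [A(G)] to
    the units of [T].
    - A series that commutes with [X_v] involves only letters of the star of
      [v]: in [X_v t = t' X_v] the word [t] can only be rotated
      ([magnus_centralizer]).  Killing the letters outside of a star is a ring
      endomorphism compatible with a retraction of the group
      ([magnus_star_proj]).  Together they give the statement on commuting
      conjugates.
    - For a word [l] whose consecutive letters are not adjacent, the
      factorisations of the monomial [l] are just its cuts into a prefix and a
      suffix, so that coefficients at such words multiply as in a free algebra
      ([magnus_conv]).  The coefficient of [gword c ^+ n] at the word [c ^ n]
      is [1], whereas a product of [k] elements carried by stars has a nonzero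
      coefficient there only if [c ^ n] is cut into [k] words each omitting
      some vertex, whence [n <= k] ([pieces_of_power]).

    Finally the extension graph of a connected graph is connected
    ([reach_translate]), so the displacement [d(x, x ^ (g ^+ n))] is a
    subadditive sequence of natural numbers, and Fekete's lemma turns the lower
    bound into a positive limit. *)

Import Order.TTheory GRing.Theory Num.Theory.
Import numFieldNormedType.Exports.

Set Implicit Arguments.
Unset Strict Implicit.
Unset Printing Implicit Defensive.

(** * Power-series operators [1 + x] *)

(** Power series over a monoid of monomials [P] are arbitrary functions
    [P -> int].  When [i] is multiplication by a variable, which is injective,
    [push i] is multiplication of series by that variable.  The size function
    makes [1 + push i] invertible, like the series [1 + x]. *)
Section Push.
Local Open Scope ring_scope.
Variables (P : Type) (i : P -> P) (sz : P -> nat).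
Hypothesis i_inj : injective i.
Hypothesis sz_i : forall t, (sz t < sz (i t))%N.
Implicit Types (f h : P -> int) (t s : P).

Definition push f t : int :=
  if pselect (exists s, i s = t) is left e then f (projT1 (cid e)) else 0.

Lemma push_in f s : push f (i s) = f s.
Proof.
rewrite /push; case: pselect => [e|]; last by case; exists s.
by case: (cid e) => s' /= /i_inj ->.
Qed.

Lemma push_out f t : ~ (exists s, i s = t) -> push f t = 0.
Proof. by rewrite /push; case: pselect. Qed.

Variant push_spec f t : int -> Prop :=
  | PushIn s of t = i s : push_spec f t (f s)
  | PushOut of ~ (exists s, i s = t) : push_spec f t 0.

Lemma pushP f t : push_spec f t (push f t).
Proof.
case: (pselect (exists s, i s = t)) => [[s <-]|no]; first by rewrite push_in; exact: PushIn.
by rewrite push_out//; exact: PushOut.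
Qed.

Lemma pushD f h : push (f \+ h) = push f \+ push h.
Proof.
apply/funext => t /=; case: (pselect (exists s, i s = t)) => [[s <-]|no].
  by rewrite !push_in.
by rewrite !push_out.
Qed.

Definition oneplus f : P -> int := f \+ push f.

(** The inverse solves [h = f - push i h]; the recursion stops because the
    argument shrinks each time that [push i] is evaluated. *)
Fixpoint oneplus_inv_fuel k f t : int :=
  if k is k'.+1 then f t - push (oneplus_inv_fuel k' f) t else 0.

Definition oneplus_inv f t := oneplus_inv_fuel (sz t).+1 f t.

Lemma oneplus_inv_fuel_stable f k t :
  (sz t < k)%N -> oneplus_inv_fuel k.+1 f t = oneplus_inv_fuel k f t.
Proof.
elim: k t => // k IH t tk; rewrite [LHS]/= [RHS]/=; congr (_ - _).
case: (pselect (exists s, i s = t)) => [[s e]|no]; last by rewrite !push_out.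
rewrite -e !push_in -[LHS]/(oneplus_inv_fuel k.+1 f s) IH //.
by have := sz_i s; rewrite e; lia.
Qed.

Lemma oneplus_inv_fuelE f k t :
  (sz t < k)%N -> oneplus_inv_fuel k f t = oneplus_inv f t.
Proof.
move=> /subnK <-; elim: (k - _)%N => [|n IH] //.
by rewrite -IH addSn oneplus_inv_fuel_stable // ltn_addl.
Qed.

Lemma oneplus_invK f : oneplus (oneplus_inv f) = f.
Proof.
apply/funext => t; rewrite /oneplus /= {1}/oneplus_inv /=.
case: (pselect (exists s, i s = t)) => [[s <-]|no].
  by rewrite !push_in oneplus_inv_fuelE // subrK.
by rewrite !push_out // subr0 addr0.
Qed.

Lemma oneplus_inj : injective oneplus.
Proof.
move=> f h fh; apply/funext => t; move: {2}(sz t).+1 (ltnSn (sz t)) => n.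
elim: n t => // n IH t tn.
have := congr1 (fun k => k t) fh; rewrite /oneplus /=.
case: (pushP f t) => [s ts|no]; last by rewrite push_out // !addr0.
rewrite ts push_in (IH s); first exact: addIr.
by have := sz_i s; rewrite -ts; lia.
Qed.

Lemma oneplusK f : oneplus_inv (oneplus f) = f.
Proof. by apply: oneplus_inj; rewrite oneplus_invK. Qed.

Lemma oneplusD f h : oneplus (f \+ h) = oneplus f \+ oneplus h.
Proof. by apply/funext => t; rewrite /oneplus /= pushD /= addrACA. Qed.

End Push.

Lemma push_comm (P : Type) (i j : P -> P) (f : P -> int) :
  injective i -> injective j -> (forall t, i (j t) = j (i t)) ->
  push i (push j f) = push j (push i f).
Proof.
move=> iI jI ij; apply/funext => t.
case: (@pushP _ i iI (push j f) t) => [s ->|no].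
  case: (@pushP _ j jI f s) => [r ->|no']; first by rewrite ij !push_in.
  case: (@pushP _ j jI _ (i s)) => [r e|//].
  rewrite push_out // => -[q qr]; apply: no'; exists q.
  by apply: iI; rewrite ij qr e.
case: (@pushP _ j jI _ t) => [r e|//].
by rewrite push_out // => -[q qr]; apply: no; exists (j q); rewrite ij qr e.
Qed.

Lemma oneplus_push (P : Type) (i j : P -> P) (f : P -> int) :
  injective i -> injective j -> (forall t, i (j t) = j (i t)) ->
  oneplus i (push j f) = push j (oneplus i f).
Proof. by move=> iI jI ij; rewrite /oneplus pushD // push_comm. Qed.

Lemma oneplus_comm (P : Type) (i j : P -> P) (f : P -> int) :
  injective i -> injective j -> (forall t, i (j t) = j (i t)) ->
  oneplus i (oneplus j f) = oneplus j (oneplus i f).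
Proof.
move=> iI jI ij; have -> : oneplus j f = (f \+ push j f)%R by [].
by rewrite oneplusD // oneplus_push.
Qed.

(** * The Magnus map of a right-angled Artin group *)

Lemma cat_injl (T : Type) (r : seq T) : injective (cat r).
Proof. by elim: r => //= c r IH s t [/IH]. Qed.

Lemma cat_injr (T : Type) (r : seq T) : injective (cat^~ r).
Proof. by move=> s t /(congr1 rev); rewrite !rev_cat => /cat_injl /(can_inj revK). Qed.

Section Magnus.
Local Open Scope group_scope.
Variable G : sgraph.
Implicit Types (a b u v : G) (l : seq G) (g h x y : raag G).

(** A trace is a word up to exchange of adjacent (hence commuting) letters.  It
    is determined by its projections to the pairs of letters that are not
    adjacent, including the pairs [(a, a)], so traces are represented inside a
    product of free monoids.  This makes cancellation immediate and turns
    equality of traces into plain equality.  The empty word is a dummy value at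
    adjacent pairs. *)
Definition trace : Type := G * G -> seq G.
Implicit Types (s t : trace) (f : trace -> int).

Definition trace_of l : trace := fun p =>
  if sadj p.1 p.2 then [::] else [seq c <- l | pred2 p.1 p.2 c].

Definition tmul s t : trace := fun p => s p ++ t p.

Lemma tmulA s t r : tmul s (tmul t r) = tmul (tmul s t) r.
Proof. by apply/funext => p; rewrite /tmul catA. Qed.

Lemma trace_of_cat l1 l2 : trace_of (l1 ++ l2) = tmul (trace_of l1) (trace_of l2).
Proof. by apply/funext => p; rewrite /tmul /trace_of; case: ifP => // _; rewrite filter_cat. Qed.

Lemma trace_of_comm a b : sadj a b ->
  tmul (trace_of [:: a]) (trace_of [:: b]) = tmul (trace_of [:: b]) (trace_of [:: a]).
Proof.
move=> ab; have nab : (a == b) = false.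
  by apply: contraTF ab => /eqP ->; rewrite sadj_irr.
have nba : (b == a) = false by rewrite eq_sym.
apply/funext => -[c d]; rewrite /tmul /trace_of /=; case: ifPn => // cd.
case: (eqVneq a c) cd => [<-|ac]; case: (eqVneq b d) => [<-|bd] /=;
  rewrite ?ab ?nab ?nba ?orbT ?cats0 // => cd.
case: (eqVneq a d) cd => [<-|_] //=; case: (eqVneq b c) => [<-|_] //=.
by rewrite sadj_sym ab.
Qed.

Definition mulr_letter a t := tmul t (trace_of [:: a]).
Definition mull_letter a t := tmul (trace_of [:: a]) t.

Lemma mulr_letter_inj a : injective (mulr_letter a).
Proof.
move=> s t st; apply/funext => p; have := congr1 (fun k => k p) st.
exact: cat_injr.
Qed.

Lemma mull_letter_inj a : injective (mull_letter a).
Proof.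
move=> s t st; apply/funext => p; have := congr1 (fun k => k p) st.
exact: cat_injl.
Qed.

Lemma mulr_letter_size a t : size (t (a, a)) < size (mulr_letter a t (a, a)).
Proof.
by rewrite /mulr_letter /tmul size_cat /trace_of /= sadj_irr /= eqxx /= addn1.
Qed.

Lemma mull_mulr_letter a b t :
  mull_letter a (mulr_letter b t) = mulr_letter b (mull_letter a t).
Proof. by rewrite /mulr_letter /mull_letter tmulA. Qed.

Lemma mulr_letter_comm a b t :
  sadj a b -> mulr_letter a (mulr_letter b t) = mulr_letter b (mulr_letter a t).
Proof. by move=> ab; rewrite /mulr_letter -!tmulA (trace_of_comm ab). Qed.

Lemma trace_of_rcons l a : trace_of (rcons l a) = mulr_letter a (trace_of l).
Proof. by rewrite -cats1 trace_of_cat. Qed.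

(** [A(G)] acts on power series by right multiplication, the generator [a]
    acting as multiplication by [1 + X_a]. *)
Definition letter_op f (c : G * bool) : trace -> int :=
  if c.2 then oneplus (mulr_letter c.1) f
  else oneplus_inv (mulr_letter c.1) (fun t => size (t (c.1, c.1))) f.

Definition word_op f (w : word G) := foldl letter_op f w.

Let opK a f : letter_op (letter_op f (a, true)) (a, false) = f.
Proof. exact: (oneplusK (@mulr_letter_inj a) (@mulr_letter_size a)). Qed.
Let opVK a f : letter_op (letter_op f (a, false)) (a, true) = f.
Proof. exact: (oneplus_invK (@mulr_letter_inj a) (@mulr_letter_size a)). Qed.

Lemma word_op_eq (u w : word G) f :
  pres_eq (@raag_relators G) u w -> word_op f u = word_op f w.
Proof.
move=> uw; elim: uw f => {u w} [u|u v _ IH|u v w _ IH1 _ IH2|u w x b|u w r [a [b [ab ->]]]] f.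
- by [].
- by rewrite IH.
- by rewrite IH1 IH2.
- rewrite /word_op !foldl_cat /=; congr foldl.
  by case: b; rewrite ?opK ?opVK.
- rewrite /word_op !foldl_cat /=; congr foldl.
  set f0 := foldl _ _ _.
  set f1 := letter_op _ (a, false); set f2 := letter_op f1 _.
  have -> : letter_op (letter_op f2 (a, true)) (b, true)
     = letter_op (letter_op f2 (b, true)) (a, true).
    by apply: oneplus_comm; [exact: mulr_letter_inj..|];
      move=> t; rewrite mulr_letter_comm // sadj_sym.
  by rewrite !opVK.
Qed.

Definition gact f g := word_op f (repr g).

Lemma gact_pi f w : gact f (\pi_(raag G)%qT w) = word_op f w.
Proof. exact/word_op_eq/pres_repr. Qed.


Lemma gactM f g h : gact f (g * h) = gact (gact f g) h.
Proof.
elim/presW: g => u; elim/presW: h => w.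
by rewrite -presM !gact_pi /word_op foldl_cat.
Qed.

Lemma gact1 f : gact f 1 = f.
Proof. by rewrite -pres1 gact_pi. Qed.

Lemma gact_gen f a : gact f (raag_gen a) = oneplus (mulr_letter a) f.
Proof. exact: gact_pi. Qed.

Lemma gactK g : cancel (gact^~ g) (gact^~ g^-1).
Proof. by move=> f; rewrite -gactM mulgV gact1. Qed.

Lemma gactVK g : cancel (gact^~ g^-1) (gact^~ g).
Proof. by move=> f; rewrite -gactM mulVg gact1. Qed.

Lemma raag_ind (P : raag G -> Prop) :
  P 1 -> (forall g a, P g -> P (g * raag_gen a)) ->
  (forall g a, P g -> P (g * (raag_gen a)^-1)) -> forall g, P g.
Proof.
move=> P1 Pgen PV; elim/presW; elim/last_ind => [|w [a b] IH]; first by rewrite pres1.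
rewrite -cats1 presM; case: b; first exact: Pgen.
by rewrite -[[:: (a, false)]]/(inv_word [:: (a, true)]) presV; exact: PV.
Qed.

(** An operator that commutes with right multiplication by all [1 + X_a] also
    commutes with their inverses. *)
Lemma gact_commute (T : (trace -> int) -> trace -> int) :
  (forall a f, T (oneplus (mulr_letter a) f) = oneplus (mulr_letter a) (T f)) ->
  forall f g, T (gact f g) = gact (T f) g.
Proof.
move=> TU f; elim/raag_ind => [|g a IH|g a IH]; first by rewrite !gact1.
  by rewrite !gactM !gact_gen TU IH.
rewrite !gactM -IH; apply: (can_inj (gactK (raag_gen a))).
by rewrite gactVK gact_gen -TU -gact_gen gactVK.
Qed.

Lemma gactD f1 f2 g : gact (f1 \+ f2)%R g = (gact f1 g \+ gact f2 g)%R.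
Proof.
elim/raag_ind: g => [|g a IH|g a IH]; first by rewrite !gact1.
  by rewrite !gactM !gact_gen IH oneplusD //; exact: mulr_letter_inj.
rewrite !gactM IH; apply: (can_inj (gactK (raag_gen a))).
rewrite gactVK gact_gen oneplusD; last exact: mulr_letter_inj.
by rewrite -!gact_gen !gactVK.
Qed.

Definition delta : trace -> int := fun t => if `[< t = trace_of [::] >] then 1%R else 0%R.

(** The image of [g] in the units of the power series ring. *)
Definition magnus g := gact delta g.

Lemma tmul1 t : tmul t (trace_of [::]) = t.
Proof. by apply/funext => p; rewrite /tmul /trace_of if_same cats0. Qed.

Lemma tmul1l t : tmul (trace_of [::]) t = t.
Proof. by apply/funext => p; rewrite /tmul /trace_of if_same. Qed.

Lemma push_delta a : push (mulr_letter a) delta = push (mull_letter a) delta.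
Proof.
apply/funext => t.
case: (pushP (@mulr_letter_inj a) delta t) => [s ->|no].
  rewrite {1}/delta; case: asboolP => [->|ns].
    rewrite /mulr_letter tmul1l -{1}[trace_of [:: a]]tmul1 -/(mull_letter a _).
    by rewrite push_in; [rewrite /delta asboolT|exact: mull_letter_inj].
  case: (pushP (@mull_letter_inj a) delta _) => [r e|//].
  rewrite /delta; case: asboolP => // r1; case: ns.
  apply: (@mulr_letter_inj a).
  by rewrite e r1 /mull_letter /mulr_letter tmul1 tmul1l.
case: (pushP (@mull_letter_inj a) delta _) => [r e|//].
rewrite /delta; case: asboolP => // r1; case: no; exists r.
by rewrite e r1 /mull_letter /mulr_letter tmul1 tmul1l.
Qed.

(** Left multiplication by [X_a] agrees with right multiplication on the
    series [1], and commutes with the right action of the group. *)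
Lemma magnus_gen_mul a g : magnus (raag_gen a * g) = oneplus (mull_letter a) (magnus g).
Proof.
rewrite /magnus gactM gact_gen /oneplus push_delta gactD; congr (_ \+ _)%R.
symmetry; apply: gact_commute => b f.
rewrite oneplus_push //; try by [exact: mulr_letter_inj|exact: mull_letter_inj].
by move=> t; rewrite mull_mulr_letter.
Qed.

Lemma magnus_mulr x y h : magnus x = magnus y -> magnus (x * h) = magnus (y * h).
Proof. by rewrite /magnus !gactM => ->. Qed.

Lemma mull_letter_size a t : size (t (a, a)) < size (mull_letter a t (a, a)).
Proof.
by rewrite /mull_letter /tmul /trace_of /= size_cat sadj_irr /= eqxx.
Qed.

(** The Magnus image of a product depends only on the images of its factors;
    on this side the factor [1 + X_a] has to be cancelled on the left. *)
Lemma magnus_mull h x y : magnus x = magnus y -> magnus (h * x) = magnus (h * y).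
Proof.
elim/raag_ind: h x y => [|g a IH|g a IH] x y xy; rewrite ?mul1g // -!mulgA; apply: IH.
  by rewrite !magnus_gen_mul xy.
apply: (oneplus_inj (@mull_letter_inj a) (@mull_letter_size a)).
by rewrite -!magnus_gen_mul !mulVKg.
Qed.

Definition in_star u a := (a == u) || sadj u a.

(** On the trace of a word, the component [(u, a)] contains [a] exactly when
    the word does, so this says that all letters lie in the star of [u]. *)
Definition star_trace u t := forall a, ~~ in_star u a -> a \notin t (u, a).

Lemma star_trace_mulr u a t :
  star_trace u (mulr_letter a t) <-> star_trace u t /\ in_star u a.
Proof.
rewrite /star_trace /mulr_letter /tmul /trace_of /=; split.
  move=> st; split=> [b bu|].
    by have := st b bu; rewrite mem_cat => /norP[].
  apply/negPn/negP => na; have := st a na; move: na.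
  rewrite mem_cat /in_star => /norP[_ /negPf ->].
  by rewrite eqxx orbT inE eqxx orbT.
move=> [st ua] b bu; rewrite mem_cat negb_or st //=.
case: ifP => // _; case: ifP => // _; rewrite inE.
by apply: contra bu => /eqP ->.
Qed.

(** If [t] is in the support of a series commuting with [X_v], then
    [t X_v = X_v s] with [s] again in the support.  In the component [(v, a)]
    of a letter [a] not adjacent to [v], the word of [s] is the word of [t]
    with its first letter, which must be [v], moved to the end.  Iterating,
    every letter of that component is [v]. *)
Lemma magnus_centralizer v g :
  magnus (raag_gen v * g) = magnus (g * raag_gen v) ->
  forall t, magnus g t <> 0%R -> star_trace v t.
Proof.
rewrite magnus_gen_mul [in RHS]/magnus gactM gact_gen -/(magnus g) => E.
have LR t : push (mull_letter v) (magnus g) t = push (mulr_letter v) (magnus g) t.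
  by have := congr1 (fun k => k t) E; apply: addrI.
have rot t : magnus g t <> 0%R ->
    exists2 s, mulr_letter v t = mull_letter v s & magnus g s <> 0%R.
  move=> gt; have := LR (mulr_letter v t); rewrite push_in; last exact: mulr_letter_inj.
  case: (pushP (@mull_letter_inj v) (magnus g) _) => [s e|_ /esym//].
  by move=> es; exists s; rewrite ?es.
move=> t0 gt0 a; rewrite /in_star => /norP[av va].
have nthv k t : magnus g t <> 0%R -> k < size (t (v, a)) -> nth v (t (v, a)) k = v.
  elim: k t => [|k IH] t /rot[s st gs] kt.
    have := congr1 (fun q => nth v (q (v, a)) 0) st.
    rewrite /mulr_letter /mull_letter /tmul /trace_of /= (negPf va) eqxx /=.
    by rewrite nth_cat kt.
  have E2 : t (v, a) ++ [:: v] = v :: s (v, a).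
    have := congr1 (fun q => q (v, a)) st.
    by rewrite /mulr_letter /mull_letter /tmul /trace_of /= (negPf va) eqxx.
  have sz : size (t (v, a)) = size (s (v, a)).
    by have := congr1 size E2; rewrite size_cat addn1 => -[].
  have := congr1 (fun q => nth v q k.+1) E2; rewrite nth_cat kt /= => ->.
  by apply: IH => //; rewrite -sz ltnW.
apply/negP => /(nthP v)[k kt] na; move: av; rewrite -na nthv ?eqxx //.
Qed.

(** The retraction onto the subgroup generated by the star of [u]. *)
Definition star_proj u : raag G -> raag G :=
  raag_lift (fun a => if in_star u a then raag_gen a else 1).

Lemma star_proj_comm u a b : sadj a b ->
  commute (if in_star u a then raag_gen a else 1 : raag G)
          (if in_star u b then raag_gen b else 1).
Proof.
move=> ab; case: ifP => _; case: ifP => _;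
  by [exact: raag_gen_commute|exact: commute1|exact/commute_sym/commute1].
Qed.

Lemma star_projM u : {morph star_proj u : x y / x * y}.
Proof. exact/raag_liftM/star_proj_comm. Qed.

Lemma star_proj_gen u a :
  star_proj u (raag_gen a) = if in_star u a then raag_gen a else 1.
Proof. by rewrite /star_proj raag_lift_gen //; exact: star_proj_comm. Qed.

Lemma star_proj1 u : star_proj u 1 = 1.
Proof. by apply: (mulgI (star_proj u 1)); rewrite -star_projM !mulg1. Qed.

Lemma star_projV u : {morph star_proj u : x / x^-1}.
Proof.
by move=> x; apply: (mulgI (star_proj u x)); rewrite -star_projM !mulgV star_proj1.
Qed.

Definition star_trunc u f : trace -> int :=
  fun t => if `[< star_trace u t >] then f t else 0%R.

(** Killing the variables outside of the star of [u] is multiplicative. *)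
Lemma star_trunc_oneplus u a f : star_trunc u (oneplus (mulr_letter a) f) =
  if in_star u a then oneplus (mulr_letter a) (star_trunc u f) else star_trunc u f.
Proof.
apply/funext => t; rewrite /star_trunc [oneplus]lock; case: asboolP => ut.
  rewrite -lock /oneplus /=; case: ifPn => ua /=.
    rewrite asboolT //; congr (_ + _)%R.
    case: (pushP (@mulr_letter_inj a) _ t) => [s e|no]; last by rewrite push_out.
    rewrite e push_in; last exact: mulr_letter_inj.
    by rewrite asboolT //; move: ut; rewrite e star_trace_mulr => -[].
  rewrite asboolT // push_out ?addr0 // => -[s e].
  by move: ut; rewrite -e star_trace_mulr (negPf ua) => -[].
case: ifPn => ua; rewrite -?lock ?asboolF //.
rewrite /oneplus /= asboolF // add0r.
case: (pushP (@mulr_letter_inj a) _ t) => [s e|no //].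
rewrite asboolF // => us; apply: ut; rewrite e star_trace_mulr //.
Qed.

Lemma star_trunc_gact u f g :
  star_trunc u (gact f g) = gact (star_trunc u f) (star_proj u g).
Proof.
elim/raag_ind: g => [|g a IH|g a IH]; first by rewrite star_proj1 !gact1.
  rewrite star_projM star_proj_gen !gactM gact_gen star_trunc_oneplus IH.
  by case: ifP => _; rewrite ?gact1 ?gact_gen.
rewrite star_projM star_projV star_proj_gen !gactM -IH.
have := star_trunc_oneplus u a (gact (gact f g) (raag_gen a)^-1).
rewrite -!gact_gen gactVK => ->; case: ifP => _; first by rewrite gactK.
by rewrite invg1 gact1.
Qed.

Lemma star_trace1 u : star_trace u (trace_of [::]).
Proof. by move=> a _; rewrite /trace_of if_same. Qed.

Lemma magnus_star_proj u g : magnus (star_proj u g) = star_trunc u (magnus g).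
Proof.
rewrite /magnus star_trunc_gact; congr gact; apply/funext => t.
rewrite /star_trunc /delta; case: asboolP => [->|//]; last by case: ifP.
by rewrite asboolT //; exact: star_trace1.
Qed.

(** The elements whose series involves only letters of one star.  They include
    the star subgroups, which are fixed by [star_proj], and the centralizers of
    generators.  Working with series supports avoids the injectivity of the
    Magnus map. *)
Definition star_like g := exists u, forall t, magnus g t <> 0%R -> star_trace u t.

Lemma star_like_proj u g : star_like (star_proj u g).
Proof. by exists u => t; rewrite magnus_star_proj /star_trunc; case: asboolP. Qed.

(** As [v ^ g] commutes with [u], its series is unchanged by truncation to the
    star of [u], so [v ^ g] and its retraction have the same series.  If [v]
    were outside of the star of [u], that retraction would be [1], although the
    series of [v] is [1 + X_v].  Hence the retraction is [v ^ q2], where [q2]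
    is the retraction of [g], and [g * q2^-1] commutes with [v] as far as
    series can tell. *)
Lemma commute_conj_star_like u v g :
  commute (raag_gen u) (raag_gen v ^ g) ->
  exists q1 q2, [/\ g = q1 * q2, star_like q1 & star_like q2].
Proof.
move=> uvg.
have E : magnus (raag_gen v ^ g) = magnus (star_proj u (raag_gen v ^ g)).
  rewrite magnus_star_proj; apply/funext => t; rewrite /star_trunc.
  case: asboolP => // nt; apply/eqP/negPn/negP => /eqP.
  by move/(magnus_centralizer _) => /(_ u) => H; apply: nt; apply: H; rewrite uvg.
move: E; rewrite {2}conjgE !star_projM star_projV star_proj_gen.
case: ifP => uv E.
  set q2 := star_proj u g in E *.
  exists (g * q2^-1), q2; split; [by rewrite mulgVK| |exact: star_like_proj].
  exists v; apply: magnus_centralizer.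
  transitivity (magnus (g * (raag_gen v ^ g * q2^-1))).
    by rewrite [g * (_ * _)]mulgA -conjgC mulgA.
  rewrite -[g / q2 * _]mulgA; apply: magnus_mull; rewrite (magnus_mulr _ E).
  by rewrite -!mulgA mulgV mulg1.
have := magnus_mull g E; rewrite mul1g mulVg mulg1 -conjgC => /(magnus_mulr g^-1).
rewrite mulgK mulgV => E1.
have := congr1 (fun k => k (trace_of [:: v])) E1.
rewrite /magnus gact_gen gact1 /oneplus /=.
rewrite -[trace_of [:: v]]tmul1l -/(mulr_letter v _) push_in; last exact: mulr_letter_inj.
by rewrite {2}/delta asboolT // => /eqP; rewrite -subr_eq0 addrC addKr.
Qed.

End Magnus.

(** * Coefficients at rigid words *)

Section Rigid.
Local Open Scope group_scope.
Variable G : sgraph.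
Implicit Types (a b u v : G) (l : seq G) (g h x y : raag G).
Implicit Types (s t : trace G) (f m F : trace G -> int).

Definition nonadj : rel G := fun a b => ~~ sadj a b.
(** The trace of a rigid word is represented by no other word, and only its
    last letter can be split off on the right ([push_trace_rcons]). *)
Definition rigid l := sorted nonadj l.

Lemma rigid_rcons l b : rigid (rcons l b) -> rigid l.
Proof. by case: l => //= c l; rewrite rcons_path => /andP[]. Qed.

Lemma rigid_drop n l : rigid l -> rigid (drop n l).
Proof. exact: drop_sorted. Qed.

Lemma rigid_take n l : rigid l -> rigid (take n l).
Proof. exact: take_sorted. Qed.

(** A letter [a] that is not the last one of a rigid word cannot be brought to
    its end: the letter [d] following its last occurrence is not adjacent to
    it, and stays behind [a] in the projection to [{a, d}]. *)
Lemma rigid_blocked a l b : rigid (rcons l b) -> b != a ->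
  a \notin rcons l b \/
  exists d (s : seq G), [/\ d != a, nonadj a d & [seq c <- rcons l b | pred2 a d c] = rcons s d].
Proof.
elim/last_ind: l b => [|l e IH] b rl ba; first by left; rewrite inE eq_sym.
have eb : nonadj e b.
  move: rl; case: (l) => [/andP[]//|c r].
  by rewrite /rigid /= rcons_path last_rcons => /andP[].
case: (eqVneq e a) => ea.
  right; exists b, [seq c <- rcons l e | pred2 a b c].
  by split=> //; [rewrite -ea|rewrite filter_rcons /= eqxx orbT].
have [nal|[d [s [da ad Es]]]] := IH e (rigid_rcons rl) ea.
  by left; rewrite mem_rcons inE negb_or eq_sym ba.
right; exists d; rewrite filter_rcons Es /= (negPf ba) /=.
by case: (eqVneq b d) => [->|_]; [exists (rcons s d)|exists s].
Qed.

Lemma push_trace_nil a f : push (mulr_letter a) f (trace_of [::]) = 0%R.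
Proof.
apply: push_out => -[s] /(congr1 (fun k => k (a, a))).
by rewrite /mulr_letter /tmul /trace_of /= sadj_irr /= eqxx; case: (s _).
Qed.

Lemma push_trace_rcons a f l b : rigid (rcons l b) ->
  push (mulr_letter a) f (trace_of (rcons l b)) = if a == b then f (trace_of l) else 0%R.
Proof.
move=> rl; case: eqVneq => [->|ab].
  by rewrite trace_of_rcons push_in //; exact: mulr_letter_inj.
apply: push_out => -[s E]; rewrite eq_sym in ab.
have [/negP na|[d [r [da ad Er]]]] := rigid_blocked rl ab.
  apply: na; have := congr1 (fun k => a \in k (a, a)) E.
  rewrite /mulr_letter /tmul /trace_of /= sadj_irr /= eqxx mem_cat inE eqxx orbT.
  by rewrite mem_filter => /esym /andP[].
have := congr1 (fun k => last a (k (a, d))) E.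
rewrite /mulr_letter /tmul /trace_of /= (negPf ad) /= eqxx Er last_cat last_rcons /=.
by move=> e; rewrite e eqxx in da.
Qed.

(** The coefficient at a rigid word [l] of a product of two series. *)
Definition conv f m l : int :=
  (\sum_(i < (size l).+1) f (trace_of (take i l)) * m (trace_of (drop i l)))%R.

Lemma convD f m1 m2 l : conv f (m1 \+ m2)%R l = (conv f m1 l + conv f m2 l)%R.
Proof. by rewrite /conv -big_split; apply: eq_bigr => i _; rewrite /= mulrDr. Qed.

Lemma conv_push_rcons f m a l b : rigid (rcons l b) ->
  conv f (push (mulr_letter a) m) (rcons l b) = if a == b then conv f m l else 0%R.
Proof.
move=> rl; rewrite /conv size_rcons big_ord_recr /=.
rewrite (drop_oversize (n := (size l).+1)) ?size_rcons // push_trace_nil mulr0 addr0.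
transitivity (\sum_(i < (size l).+1)
    if a == b then f (trace_of (take i l)) * m (trace_of (drop i l)) else 0)%R.
  apply: eq_bigr => i _; have il : i <= size l by rewrite -ltnS.
  rewrite drop_rcons // push_trace_rcons -?drop_rcons //; last exact: rigid_drop.
  by rewrite -cats1 takel_cat //; case: ifP; rewrite ?mulr0.
by case: ifP => // _; rewrite big1.
Qed.

Lemma conv_push_nil f m a : conv f (push (mulr_letter a) m) [::] = 0%R.
Proof. by rewrite /conv big_ord1 /= push_trace_nil mulr0. Qed.

Lemma trace_of_inj_nil l : trace_of l = trace_of [::] -> l = [::].
Proof.
case: l => // a l /(congr1 (fun k => k (a, a))).
by rewrite /trace_of /= sadj_irr /= eqxx.
Qed.

Lemma conv_delta f l : conv f (@delta G) l = f (trace_of l).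
Proof.
rewrite /conv big_ord_recr /= drop_size take_size {2}/delta asboolT // mulr1.
rewrite big1 ?add0r // => i _; rewrite /delta asboolF ?mulr0 //.
by move/trace_of_inj_nil/(congr1 size)/eqP; rewrite size_drop subn_eq0 leqNgt ltn_ord.
Qed.

(** Multiplicativity of the Magnus map, read at a rigid word.  For an inverse
    letter, both sides are the unique solution of the same recursion on the
    length of the word. *)
Lemma magnus_conv g h l :
  rigid l -> magnus (g * h) (trace_of l) = conv (magnus g) (magnus h) l.
Proof.
elim/raag_ind: h l => [|h a IH|h a IH] l rl.
- by rewrite mulg1 /magnus gact1 conv_delta.
- rewrite mulgA /magnus !gactM -/(magnus g) !gact_gen /oneplus convD -IH //= -gactM -/(magnus _).
  congr (_ + _)%R; rewrite /magnus gactM -!/(magnus _).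
  case/lastP: l rl => [|l b] rl; first by rewrite push_trace_nil conv_push_nil.
  rewrite push_trace_rcons // conv_push_rcons //; case: ifP => // _.
  by rewrite -gactM -IH //; exact: rigid_rcons rl.
- set m' := magnus (h * (raag_gen a)^-1); rewrite mulgA.
  set F' := magnus (g * h * (raag_gen a)^-1).
  have mE : magnus h = oneplus (mulr_letter a) m' by rewrite -gact_gen -gactM mulgVK.
  have FE : magnus (g * h) = oneplus (mulr_letter a) F' by rewrite -gact_gen -gactM mulgVK.
  elim/last_ind: l rl => [|l b IHl] rl.
    have := IH _ rl; rewrite mE FE /oneplus convD conv_push_nil addr0 /=.
    by rewrite push_trace_nil addr0.
  have := IH _ rl; rewrite mE FE /oneplus convD conv_push_rcons //=.
  rewrite push_trace_rcons //; case: ifP => _; last by rewrite !addr0.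
  by rewrite IHl ?(rigid_rcons rl) // => /addIr.
Qed.

Definition omits l := exists a, a \notin l.

(** What remains of being a product of [k] elements carried by stars. *)
Definition star_pieces k g := forall l, rigid l -> magnus g (trace_of l) <> 0%R ->
  exists ls, [/\ size ls = k, flatten ls = l & forall r : seq G, r \in ls -> omits r].

Lemma star_piecesM k k' g h :
  star_pieces k g -> star_pieces k' h -> star_pieces (k + k') (g * h).
Proof.
move=> gk hk l rl; rewrite magnus_conv // => nz.
have [i gi hi] : exists2 i : nat, magnus g (trace_of (take i l)) <> 0%R
   & magnus h (trace_of (drop i l)) <> 0%R.
  apply: contrapT => no; apply: nz; rewrite /conv big1 // => i _.
  apply/eqP; rewrite mulf_eq0; apply/negPn/negP => /norP[/eqP x /eqP y].
  by apply: no; exists i.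
have [ls [sl fl ol]] := gk _ (rigid_take i rl) gi.
have [ls' [sl' fl' ol']] := hk _ (rigid_drop i rl) hi.
exists (ls ++ ls'); rewrite size_cat sl sl' flatten_cat fl fl' cat_take_drop.
by split=> // s; rewrite mem_cat => /orP[/ol|/ol'].
Qed.

Hypothesis G_nocone : forall u, exists a, ~~ in_star u a.

Lemma star_like_pieces g : star_like g -> star_pieces 1 g.
Proof.
move=> [u gu] l rl /gu ut; exists [:: l]; rewrite /= cats0; split=> // s.
rewrite inE => /eqP ->; have [a ua] := G_nocone u; exists a.
have := ut a ua; move: ua; rewrite /in_star => /norP[_ /negPf ua].
by rewrite /trace_of /= ua mem_filter /= eqxx orbT.
Qed.

Lemma commute_gen_star_like a g : commute (raag_gen a) g -> star_like g.
Proof. by move=> ag; exists a => t; apply: magnus_centralizer; rewrite ag. Qed.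

Lemma star_pieces_ex g : exists k, star_pieces k g.
Proof.
have one a g' : commute (raag_gen a) g' -> star_pieces 1 g'.
  by move/commute_gen_star_like/star_like_pieces.
elim/raag_ind: g => [|g a [k IH]|g a [k IH]].
- exists 0 => l _; rewrite /magnus gact1 /delta; case: asboolP => // l1 _.
  by exists [::]; rewrite (trace_of_inj_nil l1).
- by exists (k + 1)%N; apply: star_piecesM => //; exact: (one a).
- by exists (k + 1)%N; apply: star_piecesM => //; apply: (one a); exact: commuteV.
Qed.

Definition gword l : raag G := \prod_(a <- l) raag_gen a.

Lemma gword_rcons l a : gword (rcons l a) = gword l * raag_gen a.
Proof. by rewrite /gword -cats1 big_cat big_seq1. Qed.

(** Component [(a, a)] of a trace counts the letters [a], so this bounds the
    degree of the series of a positive word in each variable. *)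
Lemma magnus_gword_degree l t a :
  magnus (gword l) t <> 0%R -> size (t (a, a)) <= count_mem a l.
Proof.
elim/last_ind: l t => [|l b IH] t.
  rewrite /gword big_nil /magnus gact1 /delta; case: asboolP => // ->.
  by rewrite /trace_of /= if_same.
rewrite gword_rcons /magnus gactM gact_gen -/(magnus _) /oneplus /= -cats1 count_cat.
case: (pushP (@mulr_letter_inj G b) (magnus (gword l)) t) => [s ->|_].
  case: (eqVneq (magnus (gword l) s) 0%R) => [->|/eqP /IH sz _].
    by rewrite addr0 => /IH /leq_trans; apply; exact: leq_addr.
  rewrite /mulr_letter /tmul size_cat leq_add // /trace_of /= sadj_irr /=.
  by rewrite addn0 orbb; case: ifP.
by rewrite addr0 => /IH /leq_trans; apply; exact: leq_addr.
Qed.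

Lemma magnus_gword l : magnus (gword l) (trace_of l) = 1%R.
Proof.
elim/last_ind: l => [|l b IH].
  by rewrite /gword big_nil /magnus gact1 /delta asboolT.
rewrite gword_rcons /magnus gactM gact_gen -/(magnus _) /oneplus /= trace_of_rcons.
rewrite push_in ?IH; last exact: mulr_letter_inj.
(* The leading monomial has too large a degree for the shorter word. *)
have [->|/eqP/(@magnus_gword_degree _ _ b)] :=
  eqVneq (magnus (gword l) (mulr_letter b (trace_of l))) 0%R.
  by rewrite add0r.
rewrite /mulr_letter /tmul /trace_of /= sadj_irr /= eqxx size_cat addn1.
rewrite size_filter (@eq_count _ _ (pred1 b)) ?ltnn // => c /=.
by rewrite orbb.
Qed.

(** Each piece omits a letter, hence contains no full copy of [c] and can
    reach into at most one new copy.  The prefix [s] is the rest of a copy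
    that has already been cut. *)
Lemma pieces_of_power (c : seq G) n (ls : seq (seq G)) (s : seq G) :
  0 < size c -> (forall a, a \in c) -> (forall r, r \in ls -> omits r) ->
  flatten ls = s ++ flatten (nseq n c) -> n <= size ls.
Proof.
move=> c0 cfull; elim: ls n s => [|r ls IH] [|n] s om //= E.
  by move: (congr1 size E); rewrite !size_cat /=; lia.
have rs : size r < size s + size c.
  rewrite ltnNge; apply/negP => le_r; have [a ar] := om r (mem_head _ _).
  move/negP: ar; apply; apply: (@mem_take (size s + size c)).
  have := congr1 (take (size s + size c)) E.
  rewrite takel_cat // => ->; rewrite catA -size_cat take_size_cat //.
  by rewrite mem_cat cfull orbT.
apply: (IH n (drop (size r) (s ++ c))) => [q qls|]; first by apply: om; rewrite inE qls orbT.
have := congr1 (drop (size r)) E.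
by rewrite drop_size_cat // catA drop_cat size_cat rs.
Qed.

End Rigid.

(** * The extension graph *)

Section Walk.
Variable G : sgraph.
Hypothesis G_nojoin : ~ splits_as_join G.

Lemma nojoin_nocone : 1 < #|G| -> forall u : G, exists a, ~~ in_star u a.
Proof.
move=> G1 u; apply: contrapT => no; apply: G_nojoin.
exists [set u], (~: [set u]); split.
- by apply/set0Pn; exists u; rewrite inE.
- by rewrite -card_gt0 cardsC1; case: #|G| G1 => [|[]].
- by rewrite -setI_eq0 finset.setICr.
- exact: finset.setUCr.
- move=> a b; rewrite !inE => /eqP -> bu; apply/negPn/negP => ub; apply: no.
  by exists b; rewrite /in_star (negPf bu).
Qed.

(** A connected component of the complement and the set of the other vertices
    would split [G] as a join. *)
Lemma nojoin_connect : forall x y : G, connect (@nonadj G) x y.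
Proof.
move=> x y; apply/negPn/negP => nxy; apply: G_nojoin.
exists [set z | connect (@nonadj G) x z], (~: [set z | connect (@nonadj G) x z]); split.
- by apply/set0Pn; exists x; rewrite inE connect0.
- by apply/set0Pn; exists y; rewrite !inE.
- by rewrite -setI_eq0 finset.setICr.
- exact: finset.setUCr.
- move=> a b; rewrite !inE => xa; apply: contraR => ab.
  exact: connect_trans xa (connect1 ab).
Qed.

Lemma nojoin_closed_walk (x : G) : exists p : seq G,
  [/\ path (@nonadj G) x p, last x p = x & forall a, a \in x :: p].
Proof.
suff [p [xp lp sp]] : exists p : seq G, [/\ path (@nonadj G) x p, last x p = x &
    forall a, a \in enum G -> a \in x :: p].
  by exists p; split=> // a; apply: sp; rewrite mem_enum.
elim: (enum G) => [|b s [p [xp lp sp]]]; first by exists [::].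
have [p1 xp1 lp1] := connectP (nojoin_connect x b).
have [p2 xp2 lp2] := connectP (nojoin_connect b x).
exists (p1 ++ p2 ++ p); rewrite !cat_path !last_cat -lp1 -lp2 lp xp1 xp2 xp; split=> // a.
rewrite inE -cat_cons mem_cat => /predU1P[->|/sp].
  by rewrite lp1 mem_last.
by rewrite inE (mem_cat a p2) => /predU1P[->|->]; rewrite ?mem_head ?orbT.
Qed.

(** The walk starts and ends at [x], so that [x] is repeated where two copies
    meet; this is harmless since a vertex is not adjacent to itself. *)
Lemma closed_walk_rigid (x : G) (p : seq G) n :
  path (@nonadj G) x p -> last x p = x -> rigid (flatten (nseq n (x :: p))).
Proof.
move=> xp lp; apply: (@path_sorted _ _ x).
elim: n => //= n IH; rewrite cat_path xp lp IH /nonadj sadj_irr //.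
Qed.

End Walk.

Section Translation.
Local Open Scope group_scope.
Variable G : sgraph.
Hypothesis G_nocone : forall u : G, exists a, ~~ in_star u a.
Implicit Types (x y z : ext_vertex G) (g h : raag G).

Lemma ext_vertexP x : exists (v : G) g, val x = raag_gen v ^ g.
Proof. by case: x => x /= /asboolP. Qed.

Lemma commute_conj_pieces (u v : G) g h :
  commute (raag_gen v ^ g) (raag_gen u ^ h) -> star_pieces 2 (h * g^-1).
Proof.
move=> c; have : commute (raag_gen v) (raag_gen u ^ (h * g^-1)).
  have := congr1 (conjg^~ g^-1) c.
  by rewrite [LHS]conjMg [RHS]conjMg conjgK -conjgM.
move=> /commute_conj_star_like [q1 [q2 [-> s1 s2]]].
by apply: (@star_piecesM _ 1 1); exact: star_like_pieces.
Qed.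

(** Each edge, and the final comparison of two expressions of the last vertex,
    contributes two elements carried by stars. *)
Lemma ext_path_pieces x p (u v : G) g h :
  path (@ext_adj G) x p -> val x = raag_gen v ^ g -> val (last x p) = raag_gen u ^ h ->
  star_pieces (2 * (size p).+1) (h * g^-1).
Proof.
elim: p x v g => [|y p IH] x v g /=.
  move=> _ xv xu; apply: (@commute_conj_pieces u v); rewrite -xv -xu.
  exact: commute_refl.
move=> /andP[/andP[_ /eqP xy] yp] xv lu; have [w [k yw]] := ext_vertexP y.
rewrite -(mulgVK k h) -mulgA mulnS addnC.
apply: star_piecesM; first exact: IH yp yw lu.
by apply: (@commute_conj_pieces w v); rewrite -xv -yw.
Qed.

Lemma gword_power (c : seq G) n : gword c ^+ n = gword (flatten (nseq n c)).
Proof.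
elim: n => [|n IH]; first by rewrite /gword big_nil.
by rewrite expgS IH /= /gword big_cat.
Qed.

(** The constant accounts for the conjugation by an element [h] such that [x]
    is the conjugate by [h] of a generator. *)
Lemma translation_lower_bound (v : G) (c : seq G) x :
  path (@nonadj G) v c -> last v c = v -> (forall a, a \in v :: c) ->
  exists C, forall n p, path (@ext_adj G) x p ->
    last x p = ext_act x (gword (v :: c) ^+ n) -> n <= 2 * size p + C.
Proof.
move=> vc lc cfull; have [u [h xu]] := ext_vertexP x.
have [k1 hk1] := star_pieces_ex G_nocone h^-1.
have [k2 hk2] := star_pieces_ex G_nocone h.
exists (2 + (k1 + k2)) => n p xp lp.
have E : val (last x p) = raag_gen u ^ (h * gword (v :: c) ^+ n).
  by rewrite lp /= xu conjgM.
have H := star_piecesM hk1 (star_piecesM (ext_path_pieces xp xu E) hk2).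
have {H} := H (flatten (nseq n (v :: c))) (closed_walk_rigid n vc lc).
rewrite !mulgA mulgVK mulVg mul1g gword_power magnus_gword.
case=> // [ls [sls fls ols]].
have := @pieces_of_power _ (v :: c) n ls [::] isT cfull ols fls.
rewrite sls; lia.
Qed.

Definition reach x y := exists2 p, path (@ext_adj G) x p & last x p = y.

Lemma reach_refl x : reach x x. Proof. by exists [::]. Qed.

Lemma reach_trans y x z : reach x y -> reach y z -> reach x z.
Proof.
move=> [p xp lp] [q yq lq]; exists (p ++ q); first by rewrite cat_path xp lp.
by rewrite last_cat lp.
Qed.

Lemma ext_adj_sym : symmetric (@ext_adj G).
Proof. by move=> x y; rewrite /ext_adj eq_sym [_ * _ == _]eq_sym. Qed.

Lemma reach1 x y : val x * val y = val y * val x -> reach x y.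
Proof.
move=> c; case: (eqVneq x y) => [->|xy]; first exact: reach_refl.
by exists [:: y] => //=; rewrite /ext_adj xy c eqxx.
Qed.

Lemma reach_sym x y : reach x y -> reach y x.
Proof.
move=> [p]; elim: p x => [|z p IH] x /=; first by move=> _ ->; exact: reach_refl.
move=> /andP[xz zp] lp; apply: reach_trans (IH z zp lp) _.
by exists [:: x]; rewrite //= ext_adj_sym xz.
Qed.

Lemma ext_act_inj g : injective (@ext_act G ^~ g).
Proof. by move=> x y /(congr1 val) /= /conjg_inj /val_inj. Qed.

Lemma ext_adj_act g x y : ext_adj (ext_act x g) (ext_act y g) = ext_adj x y.
Proof.
rewrite /ext_adj (inj_eq (@ext_act_inj g)) /= -!conjMg.
by rewrite (inj_eq (@conjg_inj _ g)).
Qed.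

Lemma ext_path_act g x p : path (@ext_adj G) (ext_act x g) (map (@ext_act G ^~ g) p)
  = path (@ext_adj G) x p.
Proof. by elim: p x => //= y p IH x; rewrite ext_adj_act IH. Qed.

Lemma reach_act g x y : reach x y -> reach (ext_act x g) (ext_act y g).
Proof.
move=> [p xp <-]; exists (map (@ext_act G ^~ g) p); first by rewrite ext_path_act.
exact: (last_map (@ext_act G ^~ g)).
Qed.

Lemma ext_actM x g h : ext_act x (g * h) = ext_act (ext_act x g) h.
Proof. by apply/val_inj; rewrite /= conjgM. Qed.

Lemma ext_act1 x : ext_act x 1 = x.
Proof. by apply/val_inj; rewrite /= conjg1. Qed.

Lemma vertex_conj_gen (v : G) : is_vertex_conj (raag_gen v).
Proof. by apply/asboolP; exists v, 1; rewrite conjg1. Qed.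

Definition base_vertex v : ext_vertex G := exist _ (raag_gen v) (vertex_conj_gen v).

Hypothesis G_conn : sgraph_connected G.

Lemma reach_base u v : reach (base_vertex u) (base_vertex v).
Proof.
have [p] := connectP (G_conn u v); elim: p u => [|w p IH] u /=.
  by move=> _ ->; exact: reach_refl.
move=> /andP[uw wp] lp; apply: reach_trans (IH w wp lp).
exact/reach1/raag_gen_commute.
Qed.

(** A generator [a] fixes the vertex [a], to which every generator [u] is joined
    by a path of generators; so [u] and its translate by [a] are both joined
    to [a].  Every translation is a composite of translations by generators and
    their inverses. *)
Lemma reach_translate x g : reach x (ext_act x g).
Proof.
have fix1 (a : G) h : commute (raag_gen a) h -> ext_act (base_vertex a) h = base_vertex a.
  by move=> ah; apply: val_inj; apply/conjg_fixP/commgP.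
have letter (u a : G) h : commute (raag_gen a) h ->
    reach (base_vertex u) (ext_act (base_vertex u) h).
  move=> ah; apply: reach_trans (reach_base u a) _.
  by rewrite -{1}(fix1 a h ah); apply/reach_act/reach_base.
have base u h : reach (base_vertex u) (ext_act (base_vertex u) h).
  elim/raag_ind: h => [|h a IH|h a IH]; first by rewrite ext_act1; exact: reach_refl.
    rewrite ext_actM; apply: reach_trans (letter u a (raag_gen a) _) (reach_act _ IH).
    exact: commute_refl.
  rewrite ext_actM; apply: reach_trans (letter u a _^-1 _) (reach_act _ IH).
  exact/commuteV/commute_refl.
have [u [h xu]] := ext_vertexP x.
have -> : x = ext_act (base_vertex u) h by apply/val_inj.
by rewrite -ext_actM; apply: reach_trans (reach_sym (base u h)) (base _ _).
Qed.

End Translation.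

(** * Displacements and loxodromic elements *)

Section Fekete.
Variables (R : realType) (a : nat -> nat).
Hypothesis aD : forall m n, a (m + n) <= a m + a n.

Lemma subadditive_mul q m r : a (q * m + r) <= q * a m + a r.
Proof.
elim: q => [|q IH]; first by rewrite !mul0n !add0n.
by rewrite !mulSn -!addnA; apply: leq_trans (aD _ _) _; rewrite leq_add2l.
Qed.

(** Fekete's lemma: the limit is the infimum of the quotients, so it inherits
    their lower bounds. *)
Lemma fekete : exists l : R,
  (forall k : R, (forall n, k * n%:R <= (a n)%:R)%R -> (k <= l)%R) /\
  ((fun n => n%:R^-1 * (a n)%:R)%R @ \oo --> l)%classic.
Proof.
pose S : set R := [set (n.+1%:R^-1 * (a n.+1)%:R)%R | n in [set: nat]]%classic.
have S0 : (S !=set0)%classic by exists (1%:R^-1 * (a 1)%:R)%R, 0.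
have lbS (k : R) : (forall n, k * n%:R <= (a n)%:R)%R -> lbound S k.
  move=> ka _ [n _ <-]; rewrite mulrC ler_pdivlMr ?ltr0n //; exact: ka.
have Slb : has_lbound S by exists 0%R; apply: lbS => n; rewrite mul0r.
have Sinf : has_inf S by split.
exists (inf S); split=> [k /lbS ka|]; first exact: lb_le_inf.
apply/cvgrPdist_le => e e0.
have e20 : (0 < e / 2)%R by rewrite divr_gt0.
have [_ [m _ <-] am] := inf_adherent e20 Sinf.
set M := m.+1 in am.
(* A bound for the values at the remainders modulo [M]. *)
pose B := a 0 + M * a 1.
have ar r : r < M -> a r <= B.
  move=> rM; have := subadditive_mul r 1 0; rewrite muln1 addn0 => /leq_trans; apply.
  by rewrite addnC leq_add2l leq_mul2r (ltnW rM) orbT.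
have M0 : (0 < M%:R :> R)%R by rewrite ltr0n.
near=> n.
have n0 : (0 < n)%N by near: n; exists 1.
have nR0 : (0 < n%:R :> R)%R by rewrite ltr0n.
have lo : (inf S <= n%:R^-1 * (a n)%:R)%R.
  by apply: ge_inf => //; exists n.-1 => //; rewrite prednK.
rewrite ler0_norm ?subr_le0 // opprB lerBlDl.
have Bn : (B%:R <= (e / 2) * n%:R :> R)%R.
  by rewrite -ler_pdivrMl // mulrC; near: n; exact: nbhs_infty_ger.
have up : ((a n)%:R * M%:R <= n%:R * (a M)%:R + B%:R * M%:R :> R)%R.
  rewrite -!natrM -natrD ler_nat {1 2}(divn_eq n M).
  apply: (leq_trans (leq_mul (subadditive_mul _ _ _) (leqnn M))).
  have := ar (n %% M) (ltn_pmod _ (ltn0Sn _)); nia.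
have am2 : ((a M)%:R <= (inf S + e / 2) * M%:R :> R)%R.
  by rewrite -ler_pdivrMr // mulrC ltW.
rewrite mulrC ler_pdivrMr // -(ler_pM2r M0); apply: (le_trans up).
have h1 : (n%:R * (a M)%:R <= n%:R * ((inf S + e / 2) * M%:R) :> R)%R.
  by rewrite ler_pM2l.
have h2 : (B%:R * M%:R <= e / 2 * n%:R * M%:R :> R)%R by rewrite ler_pM2r.
apply: (le_trans (lerD h1 h2)); rewrite le_eqVlt; apply/orP; left; apply/eqP.
by field.
Unshelve. all: by end_near.
Qed.

End Fekete.

Section Dist.
Variables (R : realType) (T : eqType) (adj : rel T).

Lemma graph_dist_le x p :
  path adj x p -> (graph_dist R adj x (last x p) <= (size p)%:R%:E)%E.
Proof. by move=> xp; apply: ereal_inf_lbound; exists p. Qed.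

Lemma graph_dist_attained x y : (exists2 p, path adj x p & last x p = y) ->
  exists p, [/\ path adj x p, last x p = y,
    graph_dist R adj x y = (size p)%:R%:E
    & forall q, path adj x q -> last x q = y -> size p <= size q].
Proof.
move=> [p0 xp0 lp0].
pose P n := `[< exists p, [/\ path adj x p, last x p = y & size p = n] >].
have exP : exists n, P n by exists (size p0); apply/asboolP; exists p0.
case: (ex_minnP exP) => n /asboolP[p [xp lp sp]] minn.
have minp q : path adj x q -> last x q = y -> size p <= size q.
  by move=> xq lq; rewrite sp; apply: minn; apply/asboolP; exists q.
exists p; split=> //; apply/eqP; rewrite eq_le -{1}lp graph_dist_le //=.
apply: le_ereal_inf_tmp => _ [q [xq lq] <-].
by rewrite lee_fin ler_nat minp.
Qed.

End Dist.

Section Main.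
Variables (R : realType) (G : sgraph).
Local Open Scope group_scope.
Hypothesis G_nocone : forall u : G, exists a, ~~ in_star u a.
Hypothesis G_conn : sgraph_connected G.

Lemma closed_walk_loxodromic (v : G) c :
  path (@nonadj G) v c -> last v c = v -> (forall a, a \in v :: c) ->
  loxodromic R (gword (v :: c)).
Proof.
move=> vc lc cfull x; set g := gword _.
have [C hC] := translation_lower_bound G_nocone x vc lc cfull.
have dist n := graph_dist_attained R (reach_translate G_conn x (g ^+ n)).
pose p n := projT1 (cid (dist n)); pose a n := size (p n).
have aP n : [/\ path (@ext_adj G) x (p n), last x (p n) = ext_act x (g ^+ n),
    graph_dist R (@ext_adj G) x (ext_act x (g ^+ n)) = (a n)%:R%:E
    & forall q, path (@ext_adj G) x q -> last x q = ext_act x (g ^+ n) -> a n <= size q].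
  exact: (projT2 (cid (dist n))).
have aD m n : a (m + n) <= a m + a n.
  have [xm lm _ _] := aP m; have [xn ln _ _] := aP n; have [_ _ _ mn] := aP (m + n)%N.
  pose q := p n ++ map (@ext_act G ^~ (g ^+ n)) (p m).
  have sq : size q = (a m + a n)%N by rewrite size_cat size_map addnC.
  rewrite -sq; apply: mn; first by rewrite cat_path xn ln ext_path_act.
  rewrite last_cat ln (last_map (@ext_act G ^~ (g ^+ n))) lm.
  by rewrite -ext_actM -expgnDr.
have aC n : n <= 2 * a n + C by have [xn ln _ _] := aP n; exact: hC.
(* Subadditivity removes the additive constant: apply the bound to [C.+1 * n]. *)
have a2 n : n <= 2 * a n.
  have := aC (C.+1 * n)%N; have := subadditive_mul aD C.+1 n 0; rewrite addn0.
  have a0 : a 0 <= 0.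
    by have [_ _ _ m0] := aP 0; apply: (m0 [::]) => //; rewrite ext_act1.
  rewrite leqNgt; nia.
have [l [lb cv]] := fekete R aD.
exists l%:E.
  rewrite lte_fin; apply: (@lt_le_trans _ _ (2^-1)%R); first by rewrite invr_gt0.
  by apply: lb => n; rewrite ler_pdivrMl // -natrM ler_nat.
have distE n : graph_dist R (@ext_adj G) x (ext_act x (g ^+ n)) = (a n)%:R%:E.
  by have [] := aP n.
under eq_fun do rewrite distE -EFinM.
by apply: cvg_EFin; [exact: nearW|exact: cv].
Qed.

Lemma raag_incl_inj : injective (raag_incl G).
Proof. by move=> g h /(bij_inj (@prodZ_raag_bij G)) []. Qed.

End Main.

Section Cone.
Variables (R : realType) (G : sgraph).
Local Open Scope group_scope.
Let cone := sjoin G point_graph.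

Lemma apex_central (g : raag cone) : commute (raag_gen (inr tt : cone)) g.
Proof.
elim/raag_ind: g => [|g a IH|g a IH]; first exact: commute1.
  apply: commuteM => //; case: a => [a|[]]; last exact: commute_refl.
  exact: raag_gen_commute.
apply: commuteM => //; apply: commuteV; case: a => [a|[]]; last exact: commute_refl.
exact: raag_gen_commute.
Qed.

Lemma cone_not_loxodromic (g : raag cone) : ~ loxodromic R g.
Proof.
move=> /(_ (base_vertex (inr tt : cone))) [l l0].
have E n : graph_dist R (@ext_adj cone) (base_vertex (inr tt : cone))
   (ext_act (base_vertex (inr tt : cone)) (g ^+ n)) = 0%E.
  have -> : ext_act (base_vertex (inr tt : cone)) (g ^+ n) = base_vertex (inr tt : cone).
    by apply: val_inj; apply/conjg_fixP/commgP/apex_central.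
  apply/eqP; rewrite eq_le (@graph_dist_le _ _ _ _ [::]) //=.
  by apply: le_ereal_inf_tmp => _ [p _ <-]; rewrite lee_fin.
under eq_fun do rewrite E mule0.
move=> /(cvg_unique _ (@cvg_cst _ _ _ _ _)) => H.
by move: l0; rewrite -H ?ltxx.
Qed.

End Cone.

Theorem proposition42 (R : realType) (G : sgraph)
    (G_gt1 : (1 < #|G|)%N)
    (G_conn : sgraph_connected G)
    (G_nojoin : ~ splits_as_join G) :
  [/\ exists g : raag G, loxodromic R g,
      injective (raag_incl G)
    & ~ preserves_loxodromic R (raag_incl G)].
Proof.
have [v _] : exists v : G, v \in G by apply/card_gt0P/ltnW.
have [c [vc lc cfull]] := nojoin_closed_walk G_nojoin v.
have lox := closed_walk_loxodromic R (nojoin_nocone G_nojoin G_gt1) G_conn vc lc cfull.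
split; [by eexists; exact: lox|exact: raag_incl_inj|].
by move=> /(_ _ lox) /cone_not_loxodromic.
Qed.
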